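(* $\mathsf{WF}\equiv_{sW}\mathsf S_L\equiv_{sW}\mathsf S$.
   Context: $\equiv_{sW}$ denotes strong Weihrauch equivalence. Graphs are countable, given by (characteristic functions of) their vertex and edge sets. $\mathsf{WF}$: given a tree $T\subseteq\mathbb N^{<\mathbb N}$, output $0$ if $T$ contains an infinite path and $1$ if it does not. $\mathsf S$ (isomorphic subgraph): given graphs $G$ and $H$, output $1$ if $H$ is isomorphic to a subgraph of $G$ and $0$ if not. $L$ is the linear graph with vertices $\{v_i:i\in\mathbb N\}$ and edges $\{(v_i,v_{i+1}):i\in\mathbb N\}$. $\mathsf S_L$: given a graph $G$, output $1$ if $L$ is isomorphic to a subgraph of $G$ and $0$ if not. *)

(* Defs.v *)
From Stdlib Require Import FunctionalExtensionality Cantor.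
From mathcomp Require Import all_boot zify.

Set Implicit Arguments.
Unset Strict Implicit.
Unset Printing Implicit Defensive.

Definition baire := nat -> nat.

Definition npair (x y : nat) : nat := Cantor.to_nat (x, y).
Definition nfst (n : nat) : nat := (Cantor.of_nat n).1.
Definition nsnd (n : nat) : nat := (Cantor.of_nat n).2.

Lemma nfstK x y : nfst (npair x y) = x.
Proof. by rewrite /nfst /npair Cantor.cancel_of_to. Qed.

Lemma nsndK x y : nsnd (npair x y) = y.
Proof. by rewrite /nsnd /npair Cantor.cancel_of_to. Qed.

Lemma npairK n : npair (nfst n) (nsnd n) = n.
Proof. by rewrite /nfst /nsnd /npair -surjective_pairing Cantor.cancel_to_of. Qed.

Lemma npair_inj x y x' y' : npair x y = npair x' y' -> x = x' /\ y = y'.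
Proof.
by move=> e; rewrite -(nfstK x y) -{2}(nsndK x y) e nfstK nsndK.
Qed.

(* Oracle programs for the unary partial recursive functions relative to an
   oracle; functions of several arguments are handled through [npair]. *)
Inductive code : Type :=
| Zero
| Succ
| Fst
| Snd
| Oracle
| Pair (c d : code)
| Comp (c d : code)
| Prec (c d : code)
| Min (c : code).

(* [eval p c n r]: program [c] with oracle [p] halts on input [n] with output
   [r].  [Prec c d] is primitive recursion on the second component of the
   input, with the first component as parameter; [Min c] is unbounded
   minimization, requiring [c] to halt at all the smaller arguments. *)
Inductive eval (p : baire) : code -> nat -> nat -> Prop :=
| EvalZero n : eval p Zero n 0
| EvalSucc n : eval p Succ n n.+1
| EvalFst n : eval p Fst n (nfst n)
| EvalSnd n : eval p Snd n (nsnd n)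
| EvalOracle n : eval p Oracle n (p n)
| EvalPair c d n a b :
    eval p c n a -> eval p d n b -> eval p (Pair c d) n (npair a b)
| EvalComp c d n a b :
    eval p d n a -> eval p c a b -> eval p (Comp c d) n b
| EvalPrec0 c d a r :
    eval p c a r -> eval p (Prec c d) (npair a 0) r
| EvalPrecS c d a m r s :
    eval p (Prec c d) (npair a m) r -> eval p d (npair a (npair m r)) s ->
    eval p (Prec c d) (npair a m.+1) s
| EvalMin c a m (r : nat -> nat) :
    eval p c (npair a m) 0 ->
    (forall k, k < m -> eval p c (npair a k) (r k).+1) ->
    eval p (Min c) a m.

Lemma eval_det p c n r r' : eval p c n r -> eval p c n r' -> r = r'.
Proof.
move=> ev; elim: ev r' => {c n r}.
- by move=> n r' e; inversion e.
- by move=> n r' e; inversion e.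
- by move=> n r' e; inversion e.
- by move=> n r' e; inversion e.
- by move=> n r' e; inversion e.
- move=> c d n a b _ IHc _ IHd r' e; inversion e; subst.
  by congr npair; [apply: IHc | apply: IHd].
- move=> c d n a b _ IHd _ IHc r' e; inversion e; subst.
  match goal with h : eval p d n _ |- _ => move: (IHd _ h) => E end.
  by subst; apply: IHc.
- move=> c d a r _ IH r'; move E: (npair a 0) => n e.
  inversion e; subst; match goal with h : npair _ _ = npair _ _ |- _ =>
    case: (npair_inj h) => // ? _ end; subst.
  exact: IH.
- move=> c d a m r s _ IH1 _ IH2 r'; move E: (npair a m.+1) => n e.
  inversion e; subst; match goal with h : npair _ _ = npair _ _ |- _ =>
    case: (npair_inj h) => // ? [?] end; subst.
  match goal with h : eval p (Prec c d) (npair a m) _ |- _ =>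
    move: (IH1 _ h) => ? end.
  by subst; apply: IH2.
- move=> c a m r _ IH0 _ IH r' e; inversion e; subst.
  case: (ltngtP m r') => // lt.
    by have [v /IH0] : exists v, eval p c (npair a m) v.+1 by eauto.
  have h : eval p c (npair a r') 0 by [].
  by move: (IH _ lt _ h).
Qed.

(* Partial maps from Baire space to itself, given by their graphs. *)
Definition operator := baire -> baire -> Prop.

Definition single_valued (F : operator) : Prop :=
  forall p q q', F p q -> F p q' -> q = q'.

Definition computable (F : operator) : Prop :=
  exists c, forall p q, F p q <-> forall n, eval p c n (q n).

Lemma computable_single_valued F : computable F -> single_valued F.
Proof.
move=> [c Fc] p q q' /Fc Fq /Fc Fq'.
by apply: functional_extensionality => n; apply: eval_det (Fq n) (Fq' n).
Qed.

(* [ocomp F G] applies [G] first. *)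
Definition ocomp (F G : operator) : operator :=
  fun p r => exists2 q, G p q & F q r.

(* [names p x]: the representation, a partial surjection from Baire space onto
   the points, maps [p] to [x]. *)
Record repSpace := RepSpace {
  point :> Type;
  names : baire -> point -> Prop;
  names_fun : forall p x y, names p x -> names p y -> x = y;
  names_surj : forall x, exists p, names p x
}.
Arguments names {r} p x.

(* Partial multivalued functions; the domain is where there is a value. *)
Definition problem (X Y : repSpace) := X -> Y -> Prop.

Definition realizer (X Y : repSpace) (f : problem X Y) (F : operator) : Prop :=
  single_valued F /\
  forall p x, names p x -> (exists y, f x y) ->
    exists q y, [/\ F p q, names q y & f x y].

Definition sW_le (X Y Z W : repSpace) (f : problem X Y) (g : problem Z W) :
    Prop :=
  exists H K, [/\ computable H, computable K &
    forall G, realizer g G -> realizer f (ocomp K (ocomp G H))].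

Definition sW_equiv (X Y Z W : repSpace) (f : problem X Y) (g : problem Z W) :
    Prop :=
  sW_le f g /\ sW_le g f.

Definition evens (p : baire) : baire := fun n => p n.*2.
Definition odds (p : baire) : baire := fun n => p n.*2.+1.
Definition interleave (p q : baire) : baire :=
  fun n => if odd n then q n./2 else p n./2.

Lemma evens_interleave p q : evens (interleave p q) = p.
Proof.
apply: functional_extensionality => n.
by rewrite /evens /interleave odd_double doubleK.
Qed.

Lemma odds_interleave p q : odds (interleave p q) = q.
Proof.
apply: functional_extensionality => n.
by rewrite /odds /interleave /= odd_double /= uphalf_double.
Qed.

Definition nat_names (p : baire) (n : nat) : Prop := p 0 = n.

Lemma nat_names_fun p x y : nat_names p x -> nat_names p y -> x = y.
Proof. by rewrite /nat_names => <- <-. Qed.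

Lemma nat_names_surj x : exists p, nat_names p x.
Proof. by exists (fun=> x). Qed.

Definition natSpace : repSpace := RepSpace nat_names_fun nat_names_surj.

Definition prod_names (X Y : repSpace) (p : baire) (xy : X * Y) : Prop :=
  names (evens p) xy.1 /\ names (odds p) xy.2.

Lemma prod_names_fun (X Y : repSpace) p (x y : X * Y) :
  prod_names p x -> prod_names p y -> x = y.
Proof.
case: x y => [x1 x2] [y1 y2] [/= h1 h2] [/= k1 k2].
by rewrite (names_fun h1 k1) (names_fun h2 k2).
Qed.

Lemma prod_names_surj (X Y : repSpace) (x : X * Y) : exists p, prod_names p x.
Proof.
case: x => x y; case: (names_surj x) => p px; case: (names_surj y) => q qy.
by exists (interleave p q); split; rewrite ?evens_interleave ?odds_interleave.
Qed.

Definition prodSpace (X Y : repSpace) : repSpace :=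
  RepSpace (@prod_names_fun X Y) (@prod_names_surj X Y).

Fixpoint seq_code (s : seq nat) : nat :=
  if s is a :: s' then (npair a (seq_code s')).+1 else 0.

Fixpoint seq_decode_rec (k n : nat) : seq nat :=
  if k isn't k'.+1 then [::] else
  if n isn't m.+1 then [::] else nfst m :: seq_decode_rec k' (nsnd m).

Definition seq_decode (n : nat) : seq nat := seq_decode_rec n n.

Lemma seq_codeK : cancel seq_code seq_decode.
Proof.
rewrite /seq_decode => s; move: (leqnn (seq_code s)).
elim: s {2 3}(seq_code s) => [|a s IH] [|k] //= le_k.
rewrite nfstK nsndK IH //.
have := Cantor.to_nat_non_decreasing a (seq_code s).
by move: le_k; rewrite /npair; lia.
Qed.

Lemma seq_decodeK : cancel seq_decode seq_code.
Proof.
rewrite /seq_decode => n; move: (leqnn n).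
move: {2 3}n => k; elim: k n => [|k IH] [|m] //= le_m.
rewrite IH ?npairK //.
have := Cantor.to_nat_non_decreasing (nfst m) (nsnd m).
by move: le_m; rewrite -/(npair _ _) npairK; lia.
Qed.

Record tree := Tree {
  tmem :> pred (seq nat);
  tree_prefix : forall s t, prefix s t -> tmem t -> tmem s
}.

Lemma tree_eq (T U : tree) : tmem T =1 tmem U -> T = U.
Proof.
case: T U => [T hT] [U hU] /= /functional_extensionality E.
move: hT hU; rewrite E => hT hU; congr Tree.
do 4!apply: functional_extensionality_dep => ?.
exact: bool_irrelevance.
Qed.

Definition tree_names (p : baire) (T : tree) : Prop :=
  forall s, p (seq_code s) = tmem T s.

Lemma tree_names_fun p T U : tree_names p T -> tree_names p U -> T = U.
Proof.
move=> pT pU; apply: tree_eq => s.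
by move: (pT s); rewrite pU; case: (tmem T s); case: (tmem U s).
Qed.

Lemma tree_names_surj T : exists p, tree_names p T.
Proof.
by exists (fun n => nat_of_bool (tmem T (seq_decode n))) => s; rewrite seq_codeK.
Qed.

Definition treeSpace : repSpace := RepSpace tree_names_fun tree_names_surj.

Record graph := Graph {
  vert : pred nat;
  edge : rel nat;
  edge_sym : symmetric edge;
  edge_irr : irreflexive edge;
  edge_vert : forall x y, edge x y -> vert x && vert y
}.

Lemma graph_eq (G H : graph) : vert G =1 vert H -> edge G =2 edge H -> G = H.
Proof.
case: G H => [V E s i v] [V' E' s' i' v'] /= /functional_extensionality eV eE.
have {}eE : E = E' by do 2!apply: functional_extensionality => ?; apply: eE.
move: s i v s' i' v'; rewrite eV eE => s i v s' i' v'.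
by congr Graph; do ?[apply: functional_extensionality_dep => ?];
  apply: eq_irrelevance.
Qed.

Definition graph_names (p : baire) (G : graph) : Prop :=
  (forall x, evens p x = vert G x) /\
  (forall x y, odds p (npair x y) = edge G x y).

Lemma graph_names_fun p G H : graph_names p G -> graph_names p H -> G = H.
Proof.
move=> [GV GE] [HV HE]; apply: graph_eq => x.
  by move: (GV x); rewrite HV; case: (vert G x); case: (vert H x).
by move=> y; move: (GE x y); rewrite HE; case: (edge G x y); case: (edge H x y).
Qed.

Lemma graph_names_surj G : exists p, graph_names p G.
Proof.
exists (interleave (fun x => vert G x) (fun n => edge G (nfst n) (nsnd n))).
split=> [x|x y]; first by rewrite evens_interleave.
by rewrite odds_interleave nfstK nsndK.
Qed.

Definition graphSpace : repSpace := RepSpace graph_names_fun graph_names_surj.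

Definition subgraph (H G : graph) : Prop :=
  (forall x, vert H x -> vert G x) /\ (forall x y, edge H x y -> edge G x y).

(* Only the values of [f] on the vertices of [H] matter. *)
Definition graph_iso (H G : graph) : Prop :=
  exists f : nat -> nat,
    [/\ forall x, vert H x -> vert G (f x),
        forall x y, vert H x -> vert H y -> f x = f y -> x = y,
        forall z, vert G z -> exists2 x, vert H x & f x = z &
        forall x y, vert H x -> vert H y -> edge G (f x) (f y) = edge H x y].

Definition iso_subgraph (H G : graph) : Prop :=
  exists2 G', subgraph G' G & graph_iso H G'.

Definition line_edge : rel nat := fun i j => (j == i.+1) || (i == j.+1).

Lemma line_edge_sym : symmetric line_edge.
Proof. by move=> i j; rewrite /line_edge orbC. Qed.

Lemma line_edge_irr : irreflexive line_edge.
Proof. by move=> i; rewrite /line_edge; lia. Qed.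

Definition line_graph : graph :=
  @Graph xpredT line_edge line_edge_sym line_edge_irr (fun _ _ _ => isT).

Definition has_path (T : tree) : Prop :=
  exists f : nat -> nat, forall n, T (mkseq f n).

Definition WF : problem treeSpace natSpace := fun T n =>
  (has_path T /\ n = 0) \/ (~ has_path T /\ n = 1).

(* The input is the pair (G, H); the question is whether H embeds in G. *)
Definition S_iso : problem (prodSpace graphSpace graphSpace) natSpace :=
  fun GH n =>
  (iso_subgraph GH.2 GH.1 /\ n = 1) \/ (~ iso_subgraph GH.2 GH.1 /\ n = 0).

Definition S_L : problem graphSpace natSpace := fun G n =>
  (iso_subgraph line_graph G /\ n = 1) \/
  (~ iso_subgraph line_graph G /\ n = 0).

(* Main.v *)
(** The reductions close up in a cycle WF <= S_L <= S <= WF. A tree, viewed as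
    an undirected graph on its nodes, contains a ray iff it has an infinite
    path: a ray can approach the root only finitely often, and once it moves
    away it never turns back. S_L is the instance H = L of S. Finally, H embeds
    in G iff the tree of finite partial embeddings of H in G has an infinite
    path. All the functionals involved are total, so that they compose by
    substituting a program for the oracle. *)
Require Import Defs.
From mathcomp Require Import all_boot zify boolp.

Set Implicit Arguments.
Unset Strict Implicit.
Unset Printing Implicit Defensive.

(** * Total recursive functionals with an oracle *)

Definition recursive (f : baire -> nat -> nat) : Prop :=
  exists c, forall p n, eval p c n (f p n).

Lemma recursive_ext f g :
  (forall p n, f p n = g p n) -> recursive f -> recursive g.
Proof. by move=> fg [c fc]; exists c => p n; rewrite -fg. Qed.

(** [code] has no identity instruction; re-pairing the two projections gives one. *)
Lemma recursive_id : recursive (fun _ n => n).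
Proof.
exists (Pair Fst Snd) => p n; rewrite -{2}[n]npairK.
by apply: EvalPair; [apply: EvalFst | apply: EvalSnd].
Qed.

Lemma recursive_comp f g :
  recursive g -> recursive f -> recursive (fun p n => g p (f p n)).
Proof.
move=> [d gd] [c fc]; exists (Comp d c) => p n.
exact: EvalComp (fc p n) (gd _ _).
Qed.

Lemma recursive_succ f : recursive f -> recursive (fun p n => (f p n).+1).
Proof.
apply: (@recursive_comp f (fun _ n => n.+1)).
by exists Succ => *; apply: EvalSucc.
Qed.

Lemma recursive_const k : recursive (fun _ _ => k).
Proof.
elim: k => [|k]; last exact: recursive_succ.
by exists Zero => *; apply: EvalZero.
Qed.

Lemma recursive_fst f : recursive f -> recursive (fun p n => nfst (f p n)).
Proof.
apply: (@recursive_comp f (fun _ n => nfst n)).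
by exists Fst => *; apply: EvalFst.
Qed.

Lemma recursive_snd f : recursive f -> recursive (fun p n => nsnd (f p n)).
Proof.
apply: (@recursive_comp f (fun _ n => nsnd n)).
by exists Snd => *; apply: EvalSnd.
Qed.

Lemma recursive_oracle f : recursive f -> recursive (fun p n => p (f p n)).
Proof.
apply: (@recursive_comp f (fun p n => p n)).
by exists Oracle => *; apply: EvalOracle.
Qed.

Lemma recursive_pair f g : recursive f -> recursive g ->
  recursive (fun p n => npair (f p n) (g p n)).
Proof.
by move=> [c fc] [d gd]; exists (Pair c d) => p n; apply: EvalPair.
Qed.

(** The basic recursion scheme: the conditional, the arithmetic and the bounded quantifier below all
    reduce to it. *)
Lemma recursive_iter b g f :
  recursive b -> recursive (fun p m => g p (nfst m) (nsnd m)) -> recursive f ->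
  recursive (fun p n => iter (b p n) (g p n) (f p n)).
Proof.
move=> rb [d gd] [c fc].
have [e pe] :
    recursive (fun p m => iter (nsnd m) (g p (nfst m)) (f p (nfst m))).
  (* [Prec] hands its step program the parameter, the counter and the value; the inner [Pair] drops
     the counter. *)
  exists (Prec c (Comp d (Pair Fst (Comp Snd Snd)))) => p m.
  rewrite -{1}[m]npairK; elim: (nsnd m) => [|k IH] /=.
    exact/EvalPrec0/fc.
  apply: EvalPrecS IH _.
  set r := iter _ _ _; set x := npair (nfst m) (npair k r).
  have ex : eval p (Pair Fst (Comp Snd Snd)) x (npair (nfst x) (nsnd (nsnd x))).
    apply: EvalPair; first exact: EvalFst.
    by apply: EvalComp; apply: EvalSnd.
  apply: EvalComp ex _; have := gd p (npair (nfst x) (nsnd (nsnd x))).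
  by rewrite /x !(nfstK, nsndK).
have := recursive_comp (ex_intro _ e pe) (recursive_pair recursive_id rb).
by apply: recursive_ext => p n; rewrite nfstK nsndK.
Qed.

(** A conditional is an iteration of length 0 or 1. *)
Lemma recursive_if (b : baire -> nat -> bool) f g :
  recursive (fun p n => b p n) -> recursive f -> recursive g ->
  recursive (fun p n => if b p n then f p n else g p n).
Proof.
move=> rb rf rg.
have := recursive_iter (g := fun p n _ => f p n) rb
  (recursive_comp rf (recursive_fst recursive_id)) rg.
by apply: recursive_ext => p n; case: (b p n).
Qed.

(** Iterating (a, b) -> (b, b + 1) from (0, 0) keeps the predecessor of the counter in the first
    component. *)
Lemma recursive_pred f : recursive f -> recursive (fun p n => (f p n).-1).
Proof.
move=> rf.
have rstep : recursive (fun _ m => npair (nsnd (nsnd m)) (nsnd (nsnd m)).+1).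
  by do ?[apply: recursive_pair | apply: recursive_succ | apply: recursive_snd
    | apply: recursive_id].
have := recursive_fst (recursive_iter
  (g := fun _ _ r => npair (nsnd r) (nsnd r).+1) rf rstep
  (recursive_const (npair 0 0))).
apply: recursive_ext => p n.
suff -> : iter (f p n) (fun r => npair (nsnd r) (nsnd r).+1) (npair 0 0)
    = npair (f p n).-1 (f p n) by rewrite nfstK.
by elim: (f p n) => //= k ->; rewrite nsndK.
Qed.

Lemma recursive_sub f g :
  recursive f -> recursive g -> recursive (fun p n => f p n - g p n).
Proof.
move=> rf rg.
have rstep : recursive (fun _ m => (nsnd m).-1).
  exact/recursive_pred/recursive_snd/recursive_id.
have := recursive_iter (g := fun _ _ r => r.-1) rg rstep rf.
apply: recursive_ext => p n.
by elim: (g p n) => [|k IH] /=; rewrite ?subn0 ?IH ?subnS.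
Qed.

Lemma recursive_eq0 f :
  recursive f -> recursive (fun p n => nat_of_bool (f p n == 0)).
Proof.
move=> rf.
have := recursive_iter (g := fun _ _ _ => 0) rf
  (recursive_const 0) (recursive_const 1).
by apply: recursive_ext => p n; case: (f p n).
Qed.

Lemma recursive_and (a b : baire -> nat -> bool) :
  recursive (fun p n => a p n) -> recursive (fun p n => b p n) ->
  recursive (fun p n => nat_of_bool (a p n && b p n)).
Proof.
move=> ra rb; have := recursive_if ra rb (recursive_const 0).
by apply: recursive_ext => p n; case: (a p n).
Qed.

Lemma recursive_or (a b : baire -> nat -> bool) :
  recursive (fun p n => a p n) -> recursive (fun p n => b p n) ->
  recursive (fun p n => nat_of_bool (a p n || b p n)).
Proof.
move=> ra rb; have := recursive_if ra (recursive_const 1) rb.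
by apply: recursive_ext => p n; case: (a p n).
Qed.

Lemma recursive_imply (a b : baire -> nat -> bool) :
  recursive (fun p n => a p n) -> recursive (fun p n => b p n) ->
  recursive (fun p n => nat_of_bool (a p n ==> b p n)).
Proof.
move=> ra rb; have := recursive_if ra rb (recursive_const 1).
by apply: recursive_ext => p n; case: (a p n).
Qed.

Lemma recursive_neg (a : baire -> nat -> bool) :
  recursive (fun p n => a p n) -> recursive (fun p n => nat_of_bool (~~ a p n)).
Proof.
move=> ra; have := recursive_if ra (recursive_const 0) (recursive_const 1).
by apply: recursive_ext => p n; case: (a p n).
Qed.

Lemma recursive_eq f g : recursive f -> recursive g ->
  recursive (fun p n => nat_of_bool (f p n == g p n)).
Proof.
move=> rf rg.
have := recursive_and (recursive_eq0 (recursive_sub rf rg))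
                      (recursive_eq0 (recursive_sub rg rf)).
by apply: recursive_ext => p n; rewrite !subn_eq0 -eqn_leq.
Qed.

Lemma recursive_double f : recursive f -> recursive (fun p n => (f p n).*2).
Proof.
move=> rf; have := recursive_iter (g := fun _ _ r => r.+2) rf
  (recursive_succ (recursive_succ (recursive_snd recursive_id)))
  (recursive_const 0).
by apply: recursive_ext => p n; elim: (f p n) => //= k ->.
Qed.

Ltac recursive_step :=
  lazymatch goal with
  | |- recursive (fun p n => n) => exact: recursive_id
  | |- recursive (fun p => p) => exact: (recursive_oracle recursive_id)
  | |- recursive (fun p n => (@?f p n).+1) => apply: recursive_succ
  | |- recursive (fun p n => (@?f p n).-1) => apply: recursive_pred
  | |- recursive (fun p n => nfst (@?f p n)) => apply: recursive_fst
  | |- recursive (fun p n => nsnd (@?f p n)) => apply: recursive_snd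
  | |- recursive (fun p n => npair (@?f p n) (@?g p n)) => apply: recursive_pair
  | |- recursive (fun p n => double (@?f p n)) => apply: recursive_double
  | |- recursive (fun p n => iter (@?b p n) (@?g p n) (@?f p n)) =>
      apply: recursive_iter
  | |- recursive (fun p n => nat_of_bool (@?f p n && @?g p n)) =>
      apply: recursive_and
  | |- recursive (fun p n => nat_of_bool (@?f p n || @?g p n)) =>
      apply: recursive_or
  | |- recursive (fun p n => nat_of_bool (@?f p n ==> @?g p n)) =>
      apply: recursive_imply
  | |- recursive (fun p n => nat_of_bool (~~ @?f p n)) => apply: recursive_neg
  | |- recursive (fun p n => nat_of_bool (@?f p n == @?g p n)) =>
      apply: recursive_eq
  | |- recursive (fun p n => p (@?f p n)) => apply: recursive_oracle
  (* [nat_of_bool] unfolds to a conditional, on which [recursive_if] loops. *)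
  | |- recursive (fun p n => nat_of_bool (@?f p n)) => fail
  | |- recursive _ => first [exact: recursive_const | apply: recursive_if]
  end.
Ltac solve_recursive := repeat recursive_step.

(** Both values are computed together, counting up from 0: the half grows exactly when the parity
    before the step is odd. *)
Lemma recursive_half_odd : recursive (fun _ n => npair n./2 (odd n)).
Proof.
pose step r :=
  npair (if nsnd r == 0 then nfst r else (nfst r).+1) (nsnd r == 0).
have rstep : recursive (fun _ m => step (nsnd m)).
  rewrite /step; solve_recursive.
have := recursive_iter (g := fun _ _ => step) recursive_id rstep
  (recursive_const (npair 0 0)).
apply: recursive_ext => _; elim=> //= k ->.
rewrite /step nfstK nsndK uphalf_half; congr npair; by case: (odd k).
Qed.

Lemma recursive_half f : recursive f -> recursive (fun p n => (f p n)./2).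
Proof.
move=> /(recursive_comp recursive_half_odd)/recursive_fst.
by apply: recursive_ext => p n; rewrite nfstK.
Qed.

Lemma recursive_odd f :
  recursive f -> recursive (fun p n => nat_of_bool (odd (f p n))).
Proof.
move=> /(recursive_comp recursive_half_odd)/recursive_snd.
by apply: recursive_ext => p n; rewrite nsndK.
Qed.

(** The state of the iteration pairs the next index with the truth value accumulated so far. *)
Lemma recursive_all (a : baire -> nat -> nat -> bool) b :
  recursive b -> recursive (fun p m => a p (nfst m) (nsnd m)) ->
  recursive (fun p n => nat_of_bool (all (a p n) (iota 0 (b p n)))).
Proof.
move=> rb ra.
pose step p n r := npair (nfst r).+1 (if a p n (nfst r) then nsnd r else 0).
have ra' : recursive (fun p m => a p (nfst m) (nfst (nsnd m))).
  have ri : recursive (fun _ m => npair (nfst m) (nfst (nsnd m))).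
    by solve_recursive.
  have := recursive_comp ra ri.
  by apply: recursive_ext => p m; rewrite nfstK nsndK.
have rstep : recursive (fun p m => step p (nfst m) (nsnd m)).
  by rewrite /step; solve_recursive; exact: ra'.
have := recursive_snd (recursive_iter rb rstep (recursive_const (npair 0 1))).
apply: recursive_ext => p n.
suff -> : iter (b p n) (step p n) (npair 0 1)
    = npair (b p n) (all (a p n) (iota 0 (b p n))) by rewrite nsndK.
elim: (b p n) => // k; rewrite iterS => ->; rewrite /step nfstK nsndK.
have -> : iota 0 k.+1 = rcons (iota 0 k) k by rewrite -addn1 iotaD cats1.
by rewrite all_rcons; case: (a p n k).
Qed.

Lemma recursive_interleave f g : recursive f -> recursive g ->
  recursive (fun p => interleave (f p) (g p)).
Proof.
move=> rf rg.
by apply: recursive_if (recursive_odd recursive_id)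
  (recursive_comp rg (recursive_half recursive_id))
  (recursive_comp rf (recursive_half recursive_id)).
Qed.

(** * Oracle substitution and total reductions *)

Fixpoint oracle_subst (d c : code) : code :=
  match c with
  | Oracle => d
  | Pair c1 c2 => Pair (oracle_subst d c1) (oracle_subst d c2)
  | Comp c1 c2 => Comp (oracle_subst d c1) (oracle_subst d c2)
  | Prec c1 c2 => Prec (oracle_subst d c1) (oracle_subst d c2)
  | Min c1 => Min (oracle_subst d c1)
  | c => c
  end.

Lemma eval_oracle_subst p q d c n r : (forall m, eval p d m (q m)) ->
  eval q c n r -> eval p (oracle_subst d c) n r.
Proof.
move=> dq; elim=> {c n r} //=; try by move=> *; constructor.
- by move=> c1 c2 n a b _ h1 _ h2; apply: EvalComp h1 h2.
- by move=> c1 c2 a m r s _ h1 _ h2; apply: EvalPrecS h1 h2.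
- by move=> c a m r _ h0 _ h; apply: EvalMin h0 h.
Qed.

Lemma recursive_subst h1 h2 :
  recursive h1 -> recursive h2 -> recursive (fun p => h2 (h1 p)).
Proof.
move=> [d hd] [c hc]; exists (oracle_subst d c) => p n.
exact: eval_oracle_subst (hd p) (hc _ _).
Qed.

(** The equivalence in [computable] also asks that no other [q] be computed, which is the
    determinism of evaluation. *)
Lemma recursive_computable h : recursive h -> computable (fun p q => q = h p).
Proof.
move=> [c hc]; exists c => p q; split=> [-> //|ev].
by apply: funext => n; apply: eval_det (ev n) (hc p n).
Qed.

(** A form of reduction without realizers. That [k] receives only [q], and not [p], is what makes it
    strong. *)
Definition reduction (X Y Z W : repSpace) (f : problem X Y) (g : problem Z W)
    (h k : baire -> baire) : Prop :=
  forall p x, names p x -> (exists y, f x y) ->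
  exists z, [/\ names (h p) z, exists w, g z w &
    forall q w, names q w -> g z w -> exists2 y, names (k q) y & f x y].

Definition tot_sW_le (X Y Z W : repSpace) (f : problem X Y) (g : problem Z W) :=
  exists h k, [/\ recursive h, recursive k & reduction f g h k].

Lemma tot_sW_leW (X Y Z W : repSpace) (f : problem X Y) (g : problem Z W) :
  tot_sW_le f g -> sW_le f g.
Proof.
move=> [h [k [rh rk red]]].
exists (fun p q => q = h p), (fun p q => q = k p).
split; [exact: recursive_computable | exact: recursive_computable |].
move=> G [Gsv Gr]; split.
  move=> p r r' [q [_ -> Gq] ->] [q' [_ -> Gq'] ->].
  by rewrite (Gsv _ _ _ Gq Gq').
move=> p x px fx; have [z [hz gz kz]] := red p x px fx.
have [q [w [Gq qw gw]]] := Gr _ _ hz gz.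
have [y ky fy] := kz q w qw gw.
by exists (k q), y; split=> //; exists q => //; exists (h p).
Qed.

Lemma tot_sW_le_trans (X Y Z W U V : repSpace) (f : problem X Y)
    (g : problem Z W) (e : problem U V) :
  tot_sW_le f g -> tot_sW_le g e -> tot_sW_le f e.
Proof.
move=> [h1 [k1 [rh1 rk1 red1]]] [h2 [k2 [rh2 rk2 red2]]].
exists (fun p => h2 (h1 p)), (fun p => k1 (k2 p)).
split; [exact: recursive_subst | exact: recursive_subst |].
move=> p x px fx; have [z [hz gz kz]] := red1 p x px fx.
have [u [hu eu ku]] := red2 _ _ hz gz.
exists u; split=> // q v qv ev.
by have [w kw gw] := ku q v qv ev; apply: kz kw gw.
Qed.

(** * Graph embeddings and image graphs *)

(** Edges are preserved but not necessarily reflected, because a subgraph need not be induced. *)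
Definition embeds (H G : graph) (f : nat -> nat) : Prop :=
  [/\ forall x, vert H x -> vert G (f x),
      forall x y, vert H x -> vert H y -> f x = f y -> x = y &
      forall x y, edge H x y -> edge G (f x) (f y)].

Section ImageGraph.
Variables (H : graph) (f : nat -> nat).

(** Membership in the image need not be decidable, hence the classical Booleans; the graph is only a
    witness and is never computed. *)
Let ivert : pred nat := fun z => `[< exists2 x, vert H x & f x = z >].
Let iedge : rel nat :=
  fun z w => `[< exists x y, [/\ edge H x y, f x = z & f y = w] >].

Lemma image_edge_sym : symmetric iedge.
Proof.
move=> z w; apply: asbool_equiv_eq.
by split=> -[x [y [e fx fy]]]; exists y, x; split=> //; rewrite edge_sym.
Qed.

Lemma image_edge_vert z w : iedge z w -> ivert z && ivert w.
Proof.
move=> /asboolP[x [y [/edge_vert/andP[vx vy] fx fy]]].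
by apply/andP; split; apply/asboolP; [exists x | exists y].
Qed.

Hypothesis f_inj : forall x y, vert H x -> vert H y -> f x = f y -> x = y.

Lemma image_edgeE x y :
  vert H x -> vert H y -> iedge (f x) (f y) = edge H x y.
Proof.
move=> vx vy; apply/asboolP/idP => [[x' [y' [e fx fy]]]|e]; last by exists x, y.
have /andP[vx' vy'] := edge_vert e.
by rewrite -(f_inj vx' vx fx) -(f_inj vy' vy fy).
Qed.

(** By injectivity no edge collapses to a loop. *)
Lemma image_edge_irr : irreflexive iedge.
Proof.
move=> z; apply/asboolP => -[x [y [e fx fy]]].
have /andP[vx vy] := edge_vert e.
by move: e; rewrite (f_inj vx vy (etrans fx (esym fy))) edge_irr.
Qed.

Definition image_graph : graph :=
  Graph image_edge_sym image_edge_irr image_edge_vert.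

Lemma image_graph_iso : graph_iso H image_graph.
Proof.
exists f; split=> //= [x vx|z /asboolP //|x y]; last exact: image_edgeE.
by apply/asboolP; exists x.
Qed.
End ImageGraph.

(** This trades the quantifier over graphs for one over maps, the image of [H] being the
    subgraph. *)
Lemma iso_subgraphP H G : iso_subgraph H G <-> exists f, embeds H G f.
Proof.
split=> [[G' [sv se] [f [fv finj _ fe]]]|[f [fv finj fe]]].
  exists f; split=> // [x /fv/sv //|x y e].
  by have /andP[vx vy] := edge_vert e; apply: se; rewrite fe.
exists (image_graph finj); last exact: image_graph_iso.
split=> [z /asboolP[x vx <-]|z w /asboolP[x [y [e <- <-]]]]; first exact: fv.
exact: fe.
Qed.

(** * Arithmetic of sequence codes *)

(** The predecessor undoes the successor in [seq_code]. At 0, the code of the empty sequence, head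
    and tail are both 0, in accordance with [head 0] and [behead]. *)
Definition code_head (n : nat) : nat := nfst n.-1.
Definition code_tail (n : nat) : nat := nsnd n.-1.

Lemma code_headE s : code_head (seq_code s) = head 0 s.
Proof. by case: s => //= a s; rewrite /code_head nfstK. Qed.

Lemma code_tailE s : code_tail (seq_code s) = seq_code (behead s).
Proof. by case: s => //= a s; rewrite /code_tail nsndK. Qed.

Lemma seq_code_eq0 s : (seq_code s == 0) = (s == [::]).
Proof. by case: s. Qed.

Lemma iter_code_tail i s : iter i code_tail (seq_code s) = seq_code (drop i s).
Proof.
elim: i s => [|i IH] s; first by rewrite drop0.
by rewrite iterSr code_tailE IH; case: s.
Qed.

(** Lets a code bound iterations and quantifiers over the positions of its sequence. *)
Lemma size_seq_code s : size s <= seq_code s.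
Proof.
elim: s => //= a s IH; rewrite ltnS (leq_trans IH) //.
by have := Cantor.to_nat_non_decreasing a (seq_code s); rewrite /npair; lia.
Qed.

Lemma seq_code_inj : injective seq_code.
Proof. exact: can_inj seq_codeK. Qed.

(** The state pairs the reversed part with the part still to be read. It is stationary once nothing
    remains, so surplus rounds are harmless. *)
Definition rev_step (r : nat) : nat :=
  if nsnd r == 0 then r
  else npair (npair (code_head (nsnd r)) (nfst r)).+1 (code_tail (nsnd r)).

Definition code_rev (n : nat) : nat := nfst (iter n rev_step (npair 0 n)).

Lemma code_revE s : code_rev (seq_code s) = seq_code (rev s).
Proof.
(* The initial 0 is the empty accumulator. The induction is over all accumulators and all numbers of
   rounds [k] with [size s <= k]. *)
rewrite /code_rev /rev -[0]/(seq_code [::]); move: (size_seq_code s).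
elim: s {1 2}(seq_code s) [::] => [|a s IH] k acc /=.
  suff -> : iter k rev_step (npair (seq_code acc) 0) = npair (seq_code acc) 0.
    by rewrite nfstK.
  by elim: k => //= k IHk; rewrite IHk // /rev_step nsndK.
case: k => // k lt_k; rewrite iterSr {2}/rev_step !(nfstK, nsndK) /=.
rewrite /code_head /code_tail /= !(nfstK, nsndK).
by rewrite -[(npair a _).+1]/(seq_code (a :: acc)) IH.
Qed.

Lemma recursive_rev : recursive (fun _ n => code_rev n).
Proof.
rewrite /code_rev /rev_step /code_head /code_tail; solve_recursive.
Qed.

(** * Trees as graphs: rays and infinite paths *)

(* A vertex codes a node of the tree listed from the leaf to the root, so
   that its parent is its tail. *)
Section TreeGraph.
Variable T : tree.

Definition parent (x y : nat) : bool := (y != 0) && (code_tail y == x).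

Definition tree_vert : pred nat := fun x => T (rev (seq_decode x)).
Definition tree_edge : rel nat := fun x y =>
  tree_vert x && tree_vert y && (parent x y || parent y x).

Lemma parent_code s t :
  reflect (exists a, t = a :: s) (parent (seq_code s) (seq_code t)).
Proof.
rewrite /parent seq_code_eq0 code_tailE (inj_eq seq_code_inj).
apply: (iffP andP) => [[]|[a ->]]; last by rewrite /= eqxx.
by case: t => // a t _ /eqP <-; exists a.
Qed.

Lemma tree_edge_sym : symmetric tree_edge.
Proof.
by move=> x y; rewrite /tree_edge orbC; congr andb; rewrite andbC.
Qed.

Lemma tree_edge_irr : irreflexive tree_edge.
Proof.
move=> x; apply: negbTE; rewrite /tree_edge orbb -(seq_decodeK x).
apply/negP => /andP[_ /parent_code[a /(congr1 size)]] /=; lia.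
Qed.

Lemma tree_edge_vert x y : tree_edge x y -> tree_vert x && tree_vert y.
Proof. by case/andP. Qed.

Definition tree_graph : graph :=
  Graph tree_edge_sym tree_edge_irr tree_edge_vert.

(** The ray runs through the finite prefixes of the path, which are distinct because their lengths
    are. *)
Lemma path_line : has_path T -> iso_subgraph line_graph tree_graph.
Proof.
move=> [f Tf]; apply/iso_subgraphP.
have Tv i : tree_vert (seq_code (rev (mkseq f i))).
  by rewrite /tree_vert seq_codeK revK.
have par i :
    parent (seq_code (rev (mkseq f i))) (seq_code (rev (mkseq f i.+1))).
  by apply/parent_code; exists (f i); rewrite mkseqS rev_rcons.
exists (fun i => seq_code (rev (mkseq f i))); split=> //= [i j _ _|i j].
  by move=> /seq_code_inj/(congr1 size); rewrite !size_rev !size_mkseq.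
by rewrite /tree_edge !Tv /=; case/orP=> /eqP ->; rewrite par ?orbT.
Qed.

(* Once a ray moves away from the root, injectivity prevents it from ever
   turning back. *)
Lemma line_path : iso_subgraph line_graph tree_graph -> has_path T.
Proof.
move=> /iso_subgraphP[f [/= fv finj fe]].
pose s i := seq_decode (f i).
have sE i : f i = seq_code (s i) by rewrite seq_decodeK.
have Ts i : T (rev (s i)) by apply: fv.
have step i : (exists a, s i.+1 = a :: s i) \/ (exists a, s i = a :: s i.+1).
  have /andP[_] : tree_edge (f i) (f i.+1).
    by apply: fe; rewrite /= /line_edge eqxx.
  by rewrite !sE => /orP[] /parent_code; [left | right].
(* Otherwise every step goes to the parent, and the length would decrease forever. *)
have [N [b sN]] : exists N a, s N.+1 = a :: s N.
  apply: contrapT => noN.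
  have dec i : i + size (s i) <= size (s 0).
    elim: i => // i IH; case: (step i) => [[a sa]|[a sa]].
      by case: noN; exists i, a.
    by move: IH; rewrite sa /=; lia.
  by have := dec (size (s 0)).+1; lia.
(* A step back from [s (N + k).+1] could only lead to its parent [s (N + k)], which the ray has
   already visited. *)
have down k : exists a, s (N + k).+1 = a :: s (N + k).
  elim: k => [|k [a IH]]; first by rewrite addn0; exists b.
  rewrite addnS; case: (step (N + k).+1) => // -[a' sa'].
  suff : N + k = (N + k).+2 by lia.
  by apply: finj => //; rewrite !sE; move: sa'; rewrite IH => -[_ ->].
(* Read from the root, the nodes from [N] on form a chain of one-entry extensions; the path is its
   limit. *)
pose t k := rev (s (N + k)).
have tS k : exists a, t k.+1 = rcons (t k) a.
  by have [a e] := down k; exists a; rewrite /t addnS e rev_cons.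
have size_t k : k <= size (t k).
  by elim: k => // k IH; have [a ->] := tS k; rewrite size_rcons ltnS.
pose g n := nth 0 (t n.+1) n.
have nth_t n d : nth 0 (t (n.+1 + d)) n = g n.
  elim: d => [|d IH]; first by rewrite addn0.
  rewrite addnS -IH; have [a ->] := tS (n.+1 + d).
  by rewrite nth_rcons ifT // (leq_trans _ (size_t _)) ?leq_addr.
(* The chain may start below the root, so [t n] can be longer than [n]; prefix closure of the tree
   makes up for this. *)
exists g => n; have -> : mkseq g n = take n (t n).
  apply: (@eq_from_nth _ 0) => [|i].
    by rewrite size_mkseq size_take_min; apply/esym/minn_idPl/size_t.
  rewrite size_mkseq => lt_in; rewrite nth_mkseq // nth_take //.
  by rewrite -(nth_t i (n - i.+1)) subnKC.
by apply: tree_prefix (Ts (N + n)); apply: prefix_take.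
Qed.
End TreeGraph.

(** * The reductions from [WF] to [S_L] and from [S_L] to [S_iso] *)

Lemma WF_le_S_L : tot_sW_le WF S_L.
Proof.
(* Vertices list nodes from the leaf, names of trees from the root, so the code is reversed before
   the oracle is queried. *)
pose V (p : baire) n := p (code_rev n) != 0.
pose E p m := [&& V p (nfst m), V p (nsnd m) &
  parent (nfst m) (nsnd m) || parent (nsnd m) (nfst m)].
pose h p := interleave (V p) (E p).
have rV f : recursive f -> recursive (fun p n => V p (f p n)).
  move=> rf; rewrite /V; solve_recursive.
  exact: recursive_comp recursive_rev rf.
have rh : recursive h.
  apply: recursive_interleave; first by apply: rV; solve_recursive.
  rewrite /E /parent /code_tail; solve_recursive; apply: rV; solve_recursive.
(* The outer functional exchanges 0 and 1: [WF] answers 0 when a path exists, [S_L] answers 1 when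
   the line embeds. *)
exists h, (fun q n => q 0 == 0); split=> //; first by solve_recursive.
move=> p T pT _; exists (tree_graph T).
have VE x : V p x = tree_vert T x.
  by rewrite /V -[in LHS](seq_decodeK x) code_revE pT /tree_vert; case: (T _).
split.
- split=> [x|x y]; first by rewrite evens_interleave VE.
  by rewrite odds_interleave /E nfstK nsndK !VE /= /tree_edge andbA.
- have [?|?] := EM (iso_subgraph line_graph (tree_graph T)).
    by exists 1; left.
  by exists 0; right.
move=> q w qw [[emb we]|[nemb we]].
  exists 0; first by rewrite /names /= /nat_names qw we.
  by left; split=> //; apply: line_path.
exists 1; first by rewrite /names /= /nat_names qw we.
by right; split=> // /path_line.
Qed.

Lemma S_L_le_S_iso : tot_sW_le S_L S_iso.
Proof.
(* A computable name of the line graph, independent of the input. *)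
pose lname := interleave (fun=> 1) (fun m => line_edge (nfst m) (nsnd m)).
have rl : recursive (fun=> lname).
  by apply: recursive_interleave; rewrite /line_edge; solve_recursive.
exists (fun p => interleave p lname), (fun q => q).
split; [by apply: recursive_interleave => //; solve_recursive
  | by solve_recursive |].
move=> p G pG ex; exists (G, line_graph); split=> //.
- split; rewrite /= ?evens_interleave ?odds_interleave //.
  split=> [x|x y]; first by rewrite evens_interleave.
  by rewrite odds_interleave nfstK nsndK.
- by move=> q w qw Sw; exists w.
Qed.

(** * Embeddings as infinite paths, and the reduction to [WF] *)

(* The nodes are the finite partial embeddings of H into G; entries at
   indices that are not vertices of H are arbitrary. *)
Section EmbeddingTree.
Variables G H : graph.

(** The case [i = j] yields the condition that vertices go to vertices. *)
Definition embedding_ok (f : nat -> nat) (i j : nat) : bool :=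
  vert H i && vert H j ==>
  [&& vert G (f i), (f i == f j) ==> (i == j) &
      edge H i j ==> edge G (f i) (f j)].

Definition embedding_node (s : seq nat) : bool :=
  all (fun i => all (embedding_ok (nth 0 s) i) (iota 0 (size s)))
    (iota 0 (size s)).

Lemma embedding_nodeP s :
  reflect (forall i j, i < size s -> j < size s -> embedding_ok (nth 0 s) i j)
    (embedding_node s).
Proof.
apply: (iffP allP) => [ok i j lti ltj|ok i].
  have := ok i; rewrite mem_iota => /(_ lti)/allP/(_ j).
  by rewrite mem_iota; apply.
rewrite mem_iota => lti; apply/allP => j; rewrite mem_iota => ltj.
exact: ok.
Qed.

(** The condition at [i] and [j] reads only these two entries. *)
Lemma embedding_node_prefix s t :
  prefix s t -> embedding_node t -> embedding_node s.
Proof.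
move=> /prefixP[u ->] /embedding_nodeP ok; apply/embedding_nodeP => i j lti ltj.
have := ok i j; rewrite size_cat !ltn_addr // => /(_ isT isT).
by rewrite /embedding_ok !nth_cat lti ltj.
Qed.

Definition embedding_tree : tree := Tree embedding_node_prefix.

(** A path is itself the embedding: each condition concerns two arguments, so a prefix of length
    [(maxn i j).+1] decides it. *)
Lemma embedding_treeP : has_path embedding_tree <-> iso_subgraph H G.
Proof.
split=> [[f Tf]|/iso_subgraphP[f [fv finj fe]]].
  have ok i j : embedding_ok f i j.
    have /embedding_nodeP/(_ i j) := Tf (maxn i j).+1.
    rewrite size_mkseq !ltnS leq_maxl leq_maxr => /(_ isT isT).
    by rewrite /embedding_ok !nth_mkseq ?ltnS ?leq_maxl ?leq_maxr.
  apply/iso_subgraphP; exists f; split=> [x vx|x y vx vy e|x y e].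
  - by have := ok x x; rewrite /embedding_ok vx => /and3P[].
  - have := ok x y; rewrite /embedding_ok vx vy e eqxx => /and3P[_ /eqP //].
  - have /andP[vx vy] := edge_vert e.
    by have := ok x y; rewrite /embedding_ok vx vy e => /and3P[].
exists f => n; apply/embedding_nodeP => i j; rewrite size_mkseq => lti ltj.
rewrite /embedding_ok !nth_mkseq //; apply/implyP => /andP[vi vj].
apply/and3P; split; first exact: fv.
  by apply/implyP => /eqP/finj ->.
by apply/implyP => /fe.
Qed.
End EmbeddingTree.

Lemma S_iso_le_WF : tot_sW_le S_iso WF.
Proof.
(* In these addresses the outermost operation selects the graph in the pair, the inner one selects
   vertices or edges. *)
pose GV (p : baire) x := p x.*2.*2 != 0.
pose GE (p : baire) x y := p (npair x y).*2.+1.*2 != 0.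
pose HV (p : baire) x := p x.*2.*2.+1 != 0.
pose HE (p : baire) x y := p (npair x y).*2.+1.*2.+1 != 0.
pose val n i := code_head (iter i code_tail n).
(* The indices run below the code instead of the length; the guard that the [i]-th tail is nonzero
   says exactly that [i] is a position. *)
pose h (p : baire) n : nat :=
  all (fun i => all (fun j =>
    (iter i code_tail n != 0) && (iter j code_tail n != 0) ==>
    (HV p i && HV p j ==>
      [&& GV p (val n i), (val n i == val n j) ==> (i == j) &
          HE p i j ==> GE p (val n i) (val n j)])) (iota 0 n)) (iota 0 n).
have rh : recursive h.
  apply: recursive_all; last apply: recursive_all;
    by rewrite /GV /GE /HV /HE /val /code_head /code_tail; solve_recursive.
exists h, (fun q n => q 0 == 0); split=> //; first by solve_recursive.
move=> p [G H] [[/= pGV pGE] [/= pHV pHE]] _; exists (embedding_tree G H).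
have bK (b : bool) : (nat_of_bool b != 0) = b by case: b.
have GVE x : GV p x = vert G x by rewrite /GV -[p _]/(evens (evens p) x) pGV bK.
have GEE x y : GE p x y = edge G x y.
  by rewrite /GE -[p _]/(odds (evens p) (npair x y)) pGE bK.
have HVE x : HV p x = vert H x by rewrite /HV -[p _]/(evens (odds p) x) pHV bK.
have HEE x y : HE p x y = edge H x y.
  by rewrite /HE -[p _]/(odds (odds p) (npair x y)) pHE bK.
split.
- move=> s /=; rewrite /h; congr nat_of_bool.
  have tailE i : (iter i code_tail (seq_code s) != 0) = (i < size s).
    by rewrite iter_code_tail seq_code_eq0 -size_eq0 size_drop subn_eq0 ltnNge.
  have valE i : val (seq_code s) i = nth 0 s i.
    by rewrite /val iter_code_tail code_headE -nth0 nth_drop addn0.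
  apply/allP/embedding_nodeP => [ok i j lti ltj|ok i _].
    have lt_code k : k < size s -> k \in iota 0 (seq_code s).
      by rewrite mem_iota => /leq_trans; apply; apply: size_seq_code.
    have /allP/(_ _ (lt_code j ltj)) := ok i (lt_code i lti).
    by rewrite !tailE lti ltj /= !(GVE, GEE, HVE, HEE, valE).
  apply/allP => j _; rewrite !tailE; apply/implyP => /andP[lti ltj].
  by have := ok i j lti ltj; rewrite !(GVE, GEE, HVE, HEE, valE).
- have [?|?] := EM (has_path (embedding_tree G H)); first by exists 0; left.
  by exists 1; right.
move=> q w qw [[path we]|[npath we]].
  exists 1; first by rewrite /names /= /nat_names qw we.
  by left; split=> //; apply/embedding_treeP.
exists 0; first by rewrite /names /= /nat_names qw we.
by right; split=> // /embedding_treeP.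
Qed.

Theorem theorem25 : sW_equiv WF S_L /\ sW_equiv S_L S_iso.
Proof.
have S_L_le_WF := tot_sW_le_trans S_L_le_S_iso S_iso_le_WF.
have S_iso_le_S_L := tot_sW_le_trans S_iso_le_WF WF_le_S_L.
by split; split; apply: tot_sW_leW;
  do ?[exact: WF_le_S_L | exact: S_L_le_S_iso].
Qed.
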